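(* A strict $(LF)$-space $E$ is $\kappa$-Fréchet–Urysohn if and only if $E$ is a Fréchet space.
   Context: A Fréchet space is a locally convex complete metrizable topological vector space (over $\mathbb R$ or $\mathbb C$). A strict $(LF)$-space is the direct limit (inductive limit), in the category of locally convex spaces and continuous linear maps, of an increasing sequence $E_0\hookrightarrow E_1\hookrightarrow E_2\hookrightarrow\cdots$ of Fréchet spaces, where each $E_n$ is a topological vector subspace of $E_{n+1}$. A topological space $X$ is $\kappa$-Fréchet–Urysohn if for every open subset $U$ of $X$ and every $x\in\overline{U}$ there is a sequence in $U$ converging to $x$. *)

(* Defs.v *)
From HB Require Import structures.
From mathcomp Require Import all_boot all_order all_algebra.
From mathcomp Require Import all_classical all_reals all_analysis.
From mathcomp.real_closed Require Export complex.

Set Implicit Arguments.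
Unset Strict Implicit.
Unset Printing Implicit Defensive.

Import Order.TTheory GRing.Theory Num.Theory.
Import numFieldNormedType.Exports.

Local Open Scope classical_set_scope.
Local Open Scope ring_scope.

Definition kappa_frechet_urysohn (T : topologicalType) : Prop :=
  forall U : set T, open U -> forall x : T, closure U x ->
    exists u : nat -> T, (forall n, U (u n)) /\ u @ \oo --> x.

Definition metrizable (R : realType) (T : topologicalType) : Prop :=
  exists d : T -> T -> R,
    [/\ forall x y, d x y = 0 <-> x = y,
        forall x y, d x y = d y x,
        forall y x z, d x z <= d x y + d y z &
        forall x, nbhs x =
          filter_from [set e : R | 0 < e] (fun e => [set y | d x y < e])].

(* The entourages carried by a [tvsType] generate its topology but need not be
   translation invariant, so the library's [cauchy] may differ from the notion
   of Cauchy filter of a topological vector space.  The latter is used here: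
   F is Cauchy when x - y tends to 0 along F x F. *)
Definition tvs_cauchy (K : numFieldType) (E : tvsType K) (F : set_system E)
  : Prop := (fun p : E * E => p.1 - p.2) @ (F, F) --> (0 : E).

Definition tvs_complete (K : numFieldType) (E : tvsType K) : Prop :=
  forall F : set_system E, ProperFilter F -> tvs_cauchy F ->
    exists l : E, F --> l.

(* Local convexity is part of [tvsType]. *)
Definition frechet_space (R : realType) (K : numFieldType) (E : tvsType K)
  : Prop := metrizable R E /\ tvs_complete E.

Definition topological_embedding (S T : topologicalType) (f : S -> T) : Prop :=
  injective f /\
  forall A : set S, open A <-> exists2 B : set T, open B & f @^-1` B = A.

(* (E, i) is a colimit of the sequence (F, j) in the category of locally convex
   spaces (not assumed Hausdorff) and continuous linear maps. *)
Definition lc_direct_limit (K : numFieldType) (F : nat -> tvsType K)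
    (j : forall n, {linear F n -> F n.+1})
    (E : tvsType K) (i : forall n, {linear F n -> E}) : Prop :=
  [/\ forall n, continuous (i n),
      forall n x, i n.+1 (j n x) = i n x &
      forall (G : tvsType K) (g : forall n, {linear F n -> G}),
        (forall n, continuous (g n)) ->
        (forall n x, g n.+1 (j n x) = g n x) ->
        exists h : {linear E -> G},
          [/\ continuous h,
              forall n x, h (i n x) = g n x &
              forall h' : {linear E -> G}, continuous h' ->
                (forall n x, h' (i n x) = g n x) -> h' =1 h]].

(* The inclusion of E_n in E_(n+1) as a topological vector subspace is given by
   a linear topological embedding. *)
Definition strict_LF_space (R : realType) (K : numFieldType) (E : tvsType K)
  : Prop :=
  exists (F : nat -> tvsType K) (j : forall n, {linear F n -> F n.+1})
         (i : forall n, {linear F n -> E}),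
    [/\ forall n, frechet_space R (F n),
        forall n, topological_embedding (j n) &
        lc_direct_limit j i].

(* Main.v *)
Require Import Defs.
From mathcomp Require Import all_boot all_order all_algebra.
From mathcomp Require Import ring_quotient finmap.
From HB Require Import structures.
From mathcomp Require Import all_classical all_reals all_analysis.

Set Implicit Arguments.
Unset Strict Implicit.
Unset Printing Implicit Defensive.

Import Order.TTheory GRing.Theory Num.Theory.
Import numFieldNormedType.Exports.

Local Open Scope classical_set_scope.
Local Open Scope ring_scope.

(** A metrizable space is kappa-Frechet-Urysohn: a point of the closure of [U]
is the limit of points of [U] chosen at distance less than [1/(n+1)] from it.

Conversely, let [E] be the limit of [F 0 -> F 1 -> F 2 -> ...], and call the
image of [F n] in [E] its [n]-th stage.  If some stage is the whole of [E],
then [E] carries the topology of that [F n], hence is a Frechet space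
([full_stage_frechet]).  Suppose that every stage is proper.  Pick [a] outside
stage 0 and a closed neighbourhood [C] of 0 which does not contain [a], and let
[U] be the set of those [y] for which, for some [k], [(k+1) y] is outside [C]
and [y] is outside stage [k].  The set [U] is open because stages are closed
([stage_closed]).  Every neighbourhood of 0 contains some [a/(k+1)], and the
[y] near [a/(k+1)] with [(k+1) y] outside [C] cannot all lie in the proper
subspace which is stage [k] ([stage_interior]), so 0 is in the closure of [U].
Yet no sequence [u] of [U] tends to 0: it would eventually stay in a single
stage [N] ([cvg_in_stage]), so that for large [n] some [m < N] would put
[(m+1) u_n] outside [C], whereas [(m+1) u_n] tends to 0 for each of these
finitely many [m].

Both properties of stages come from one construction, [avoiding_nbhs].  If [Y]
meets every stage in a finite set and does not meet stage [p], then some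
neighbourhood [V] of 0 is such that [Y] does not meet stage [p] plus [V].  The
set [V] is the union of the sums [W 0 + ... + W n], where the disks [W n] of
[F n] are chosen one after the other: [W n.+1] is small compared with [W n],
and keeps clear of the finitely many points of [Y] that appear in stage [n.+1].
The latter is possible because [F n] is complete, hence closed in [F n.+1].

The universal property is all that is known about [E], and it has to yield
three facts.  Each is obtained from one well chosen target: the quotient of [E]
by the union of the stages, with the indiscrete topology, shows that the stages
cover [E] ([limit_surj]); the product of the [F n] modulo sequences that are
eventually zero, again indiscrete, shows that the [F n -> E] are injective
([limit_inj]); and [E] itself, with the finest locally convex topology making
the [F n -> E] continuous, shows that this is the topology of [E]
([limit_nbhs]). *)

(** * Disks *)

Section Disks.
Context {K : numFieldType}.

(** The library's [convex_set], with the coefficients unbundled. *)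
Definition convex_closed (V : lmodType K) (U : set V) :=
  forall a x y, 0 <= a <= 1 -> U x -> U y -> U (a *: x + (1 - a) *: y).

Definition disk (V : lmodType K) (U : set V) :=
  (forall t x, `|t| <= 1 -> U x -> U (t *: x)) /\ convex_closed U.

Lemma convex_setP (V : lmodType K) (U : set V) :
  convex_set (U : set (convex_lmodType V)) <-> convex_closed U.
Proof.
split=> [cU a x y /andP[a0 a1] Ux Uy|cU x y l].
  have := cU x y (@Itv01 K a a0 a1); rewrite !inE; exact.
rewrite !inE => Ux Uy; apply: cU => //.
by apply/andP; split.
Qed.

Lemma convex_closed_half (V : lmodType K) (U : set V) x y :
  convex_closed U -> U (2 *: x) -> U (2 *: y) -> U (x + y).
Proof.
have h : 1 - 2^-1 = 2^-1 :> K by rewrite {1}[1]splitr mul1r addrK.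
move=> cU Ux Uy; have := cU 2^-1 _ _ _ Ux Uy.
rewrite h !scalerA mulVf ?pnatr_eq0// !scale1r; apply.
by rewrite invr_ge0 ler0n /= invf_le1 ?ltr0n// ler1n.
Qed.

Lemma disk_image (V V' : lmodType K) (f : {linear V -> V'}) (U : set V) :
  disk U -> disk (f @` U).
Proof.
move=> [b c]; split=> [t _ t1 [x Ux <-]|a _ _ a01 [x Ux <-] [y Uy <-]].
  by exists (t *: x); [exact: b|rewrite linearZ].
by exists (a *: x + (1 - a) *: y); [exact: c|rewrite linearD !linearZ].
Qed.

Lemma disk_sum (V : lmodType K) (U U' : set V) :
  disk U -> disk U' -> disk [set x + y | x in U & y in U'].
Proof.
move=> [b c] [b' c'].
split=> [t _ t1 [x Ux] [y Uy] <-|a _ _ a01 [x Ux] [y Uy] <- [x' Ux'] [y' Uy'] <-].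
  by exists (t *: x); [exact: b|exists (t *: y); [exact: b'|rewrite scalerDr]].
exists (a *: x + (1 - a) *: x'); first exact: c.
by exists (a *: y + (1 - a) *: y'); [exact: c'|rewrite !scalerDr addrACA].
Qed.
End Disks.

(** * Locally convex topologies given by a base of disks *)

Section LctvsBase.
Context {K : numFieldType}.

(** What makes the sets that contain a member of [B] the neighbourhoods of 0 of
a locally convex topology.  Stability under scaling includes halving, from
which the addition is continuous since disks are convex; absorption makes
[t |-> t *: x] continuous at 0. *)
Record lc_base (V : lmodType K) (B : set (set V)) : Prop := LcBase {
  lc_baseT : B !=set0 ;
  lc_baseI : forall U W, B U -> B W -> B (U `&` W) ;
  lc_base_disk : forall U, B U -> disk U ;
  lc_baseZ : forall c U, B U -> B [set x | U (c *: x)] ;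
  lc_base_absorb : forall U x, B U ->
    exists2 d, 0 < d & forall t, `|t| < d -> U (t *: x) }.

Lemma lc_base0 (V : lmodType K) (B : set (set V)) : lc_base B ->
  forall U, B U -> U 0.
Proof.
move=> H U BU; have [d d0 /(_ 0)] := lc_base_absorb H (0 : V) BU.
by rewrite normr0 scaler0; apply.
Qed.

(** An alias of [V], on which the base [B] determines a topology different from
the one that [V] may already carry. *)
Definition lctvs (V : lmodType K) (B : set (set V)) (H : lc_base B) : Type := V.

Section LctvsInstance.
Context (V : lmodType K) (B : set (set V)) (H : lc_base B).
Local Notation T := (lctvs H).

HB.instance Definition _ := GRing.Lmodule.on T.

Let nbs (x : T) : set_system T :=
  [set A | exists2 U, B U & forall u, U u -> A (x + u)].

Let half U : B U -> exists2 W, B W & forall x y, W x -> W y -> U (x + y).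
Proof.
move=> BU; exists [set x | U (2 *: x)]; first exact: (lc_baseZ H).
by move=> x y; apply: convex_closed_half; exact: (lc_base_disk H BU).2.
Qed.

HB.instance Definition _ := hasNbhs.Build T nbs.

Let nbs_filter (x : T) : ProperFilter (nbhs x).
Proof.
split.
  by move=> [U BU] /(_ 0); apply; exact: (lc_base0 H).
split.
- by have [U BU] := lc_baseT H; exists U.
- move=> P Q [U BU UP] [W BW WQ]; exists (U `&` W); first exact: lc_baseI.
  by move=> u [/UP ? /WQ ?]; split.
- by move=> P Q PQ [U BU UP]; exists U => // u /UP /PQ.
Qed.

Let nbs_single (x : T) A : nbhs x A -> A x.
Proof. by move=> [U BU /(_ 0)]; rewrite addr0; apply; exact: (lc_base0 H). Qed.

Let nbs_nbs (x : T) A : nbhs x A -> nbhs x (nbhs^~ A).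
Proof.
move=> [U BU UA]; have [W BW WU] := half BU; exists W => // u Wu; exists W => // w Ww.
by rewrite -addrA; apply: UA; apply: WU.
Qed.

HB.instance Definition _ := Nbhs_isNbhsTopological.Build T nbs_filter nbs_single nbs_nbs.

Let addc : continuous (fun x : T * T => x.1 + x.2).
Proof.
move=> [x y] A /= [U BU UA]; have [W BW WU] := half BU.
exists ([set x + w | w in W], [set y + w | w in W]) => /=.
  by split; exists W => // w Ww; exists w.
move=> [_ _] /= [[u Wu <-] [w Ww <-]]; rewrite addrACA; apply: UA; exact: WU.
Qed.

Let scalec : continuous (fun z : K^o * T => z.1 *: z.2).
Proof.
move=> [c x] A /= [U BU UA]; have [W BW WU] := half BU.
have [d d0 dW] := lc_base_absorb H x BW.
(* [M] bounds the norm of the scalars at distance less than [d] from [c]. *)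
pose M := `|c| + d; have M0 : 0 < M by rewrite ltr_wpDl.
exists (ball (c : K^o) d, [set x + w | w in [set w | W (M *: w)]]) => /=.
  split; first exact: nbhsx_ballx.
  by exists [set w | W (M *: w)]; [exact: (lc_baseZ H)|move=> w Ww; exists w].
move=> [c' _] /= [cc' [w Ww <-]].
have ncc' : `|c' - c| < d by rewrite distrC.
have -> : c' *: (x + w) = c *: x + ((c' - c) *: x + c' *: w).
  by rewrite addrA -scalerDl addrC [c + _]addrC subrK scalerDr addrC.
apply: UA; apply: WU; first exact: dW.
have -> : c' *: w = (c' / M) *: (M *: w) by rewrite scalerA divfK ?gt_eqF.
apply: (lc_base_disk H BW).1 => //.
rewrite normrM normfV (gtr0_norm M0) ler_pdivrMr// mul1r.
by rewrite -[c'](subrK c) (le_trans (ler_normD _ _))// addrC lerD2l ltW.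
Qed.

Let lconv : exists2 Bs : set_system T,
    (forall b, b \in Bs -> convex_set (b : set (convex_lmodType T))) & basis Bs.
Proof.
(* The members of [B] need not be open, but their interiors are convex too. *)
exists [set b | exists x U, B U /\ b = interior ([set y | U (y - x)] : set T)].
  move=> b /set_mem[x [U [BU ->]]]; apply/convex_setP => a y z a01 [P BP Py] [Q BQ Qz].
  exists (P `&` Q); first exact: lc_baseI.
  move=> u [/Py /= Uy /Qz /= Uz].
  have := (lc_base_disk H BU).2 _ _ _ a01 Uy Uz; congr U.
  rewrite !scalerBr !scalerDr addrACA -opprD -scalerDl addrC [RHS]addrC.
  rewrite subrKC scale1r; congr (_ + _).
  by rewrite addrACA -scalerDl subrKC scale1r.
split=> [b [x [U [BU ->]]]|x A [U BU UA]]; first exact: open_interior.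
exists (interior ([set y | U (y - x)] : set T)).
  split; first by exists x, U.
  by exists U => // u Uu /=; rewrite addrC addKr.
move=> y /interior_subset /= Uy; rewrite -[y](subrK x) addrC; exact: UA.
Qed.

(* [PreTopologicalLmod_isTvs] provides the uniform structure. *)
HB.instance Definition _ := PreTopologicalLmod_isTvs.Build K T addc scalec lconv.
HB.instance Definition _ := PreTopologicalNmodule_isTopologicalNmodule.Build T addc.
HB.instance Definition _ := TopologicalNmodule_isTopologicalLmodule.Build K T scalec.
HB.instance Definition _ := Uniform_isTvs.Build K T lconv.

End LctvsInstance.

Lemma lctvs_nbhs (V : lmodType K) (B : set (set V)) (H : lc_base B) (A : set V) :
  nbhs (0 : lctvs H) A <-> exists2 U, B U & U `<=` A.
Proof.
by split=> -[U BU UA]; exists U => // u /UA; rewrite add0r.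
Qed.

End LctvsBase.

Section ToLctvs.
Context {K : numFieldType} (V : lmodType K) (B : set (set V)) (H : lc_base B).
Definition to_lctvs (x : V) : lctvs H := x.
Lemma to_lctvs_linear : linear to_lctvs. Proof. by []. Qed.
HB.instance Definition _ :=
  GRing.isLinear.Build K V (lctvs H) *:%R to_lctvs to_lctvs_linear.
End ToLctvs.

Section Indiscrete.
Context {K : numFieldType} (V : lmodType K).
(** Every map into the indiscrete space is continuous, so that the universal
property of a limit can be tested on purely algebraic cocones. *)
Lemma indiscrete_base : lc_base [set @setT V].
Proof.
split=> //=; first by exists setT.
- by move=> U W -> ->; rewrite setTI.
- by move=> U ->; split.
- by move=> c U ->.
- by move=> U x ->; exists 1.
Qed.
Definition indiscrete : tvsType K := lctvs indiscrete_base.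

Lemma indiscrete_continuous (T : topologicalType) (f : T -> indiscrete) : continuous f.
Proof.
move=> x A /= [U -> UA]; apply: filterS filterT => y _ /=.
by have := UA (y - f x) I; rewrite addrC subrK.
Qed.
End Indiscrete.

(** * Neighbourhoods in topological vector spaces *)

Section Tvs.
Context {K : numFieldType}.
Implicit Types E : tvsType K.

Lemma tvs_nbhs E (x : E) A : nbhs x A <-> nbhs 0 [set y | A (x + y)].
Proof.
split=> [xA|A0].
  have := @add_continuous E (x, 0) A; rewrite /= addr0 => /(_ xA)[[P Q] /= [Px Q0] PQA].
  apply: filterS Q0 => y Qy; apply: (PQA (x, y)); split => //=.
  exact: nbhs_singleton.
by apply: filterS (nbhsT x A0) => _ [y /= Ay <-].
Qed.

Lemma tvs_nbhsZ E c A : nbhs (0 : E) A -> nbhs (0 : E) [set x | A (c *: x)].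
Proof.
move=> A0; have := @scale_continuous K E (c, 0) A.
rewrite /= scaler0 => /(_ A0)[[P Q] /= [Pc Q0] PQA].
apply: filterS Q0 => y Qy; apply: (PQA (c, y)); split => //=.
exact: nbhs_singleton.
Qed.

Lemma tvs_nbhs_half E A : nbhs (0 : E) A ->
  exists2 B, nbhs (0 : E) B & forall x y, B x -> B y -> A (x + y).
Proof.
move=> A0; have := @add_continuous E (0, 0) A.
rewrite /= addr0 => /(_ A0)[[P Q] /= [P0 Q0] PQA].
by exists (P `&` Q); [exact: filterI|move=> x y [Px _] [_ Qy]; exact: (PQA (x, y))].
Qed.

Lemma tvs_absorb E A (x : E) : nbhs (0 : E) A ->
  exists2 d : K, 0 < d & forall t : K, `|t| < d -> A (t *: x).
Proof.
move=> A0; have := @scale_continuous K E (0, x) A.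
rewrite /= scale0r => /(_ A0)[[P Q] /= [/nbhs_ballP[d d0 dP] Qx] PQA].
exists d => // t td; apply: (PQA (t, x)); split => /=; last exact: nbhs_singleton.
by apply: dP; rewrite /ball/= sub0r normrN.
Qed.

(** A convex neighbourhood [b] of 0 contains a balanced one: the set of the [x]
all of whose multiples by scalars of norm at most 1 are in [b].  It is a
neighbourhood of 0 because the scaling is continuous at [(0, 0)]. *)
Lemma tvs_disk E A : nbhs (0 : E) A ->
  exists W : set E, [/\ nbhs (0 : E) W, disk W & W `<=` A].
Proof.
move=> A0; have [Bs cvx [Bo Bb]] := @locally_convex K E.
have [b [Bsb b0] bA] := Bb 0 A A0.
have nb0 : nbhs (0 : E) b by apply: open_nbhs_nbhs; split=> //; exact: Bo.
exists [set x : E | forall t, `|t| <= 1 -> b (t *: x)]; split.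
- have := @scale_continuous K E (0, 0) b.
  rewrite /= scale0r => /(_ nb0)[[P Q] /= [/nbhs_ballP[d d0 dP] Q0] PQb].
  pose c := d / 2; have c0 : 0 < c by rewrite divr_gt0.
  apply: filterS (tvs_nbhsZ c^-1 Q0) => x Qx t t1.
  have -> : t *: x = (t * c) *: (c^-1 *: x) by rewrite scalerA mulfK ?gt_eqF.
  apply: (PQb (t * c, c^-1 *: x)); split => //=; apply: dP.
  rewrite /ball/= sub0r normrN normrM (gtr0_norm c0).
  rewrite (@le_lt_trans _ _ c)//; first by rewrite ler_piMl// ltW.
  by rewrite ltr_pdivrMr// mulr_natr mulr2n ltrDl.
- split=> [t x t1 Wx s s1|a x y a01 Wx Wy t t1].
    by rewrite scalerA; apply: Wx; rewrite normrM mulr_ile1.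
  rewrite scalerDr !scalerA mulrC [t * _]mulrC -!scalerA.
  by apply: (convex_setP b).1 => //; [apply: cvx; exact: mem_set|exact: Wx|exact: Wy].
- by move=> x /(_ 1); rewrite normr1 scale1r => Wx; apply: bA; exact: Wx.
Qed.

Lemma tvs_linear_continuous E (G : tvsType K) (f : {linear E -> G}) :
  (forall A, nbhs (0 : G) A -> nbhs (0 : E) (f @^-1` A)) -> continuous f.
Proof.
move=> f0 x A /tvs_nbhs/f0 A0; apply/tvs_nbhs; apply: filterS A0 => y /=.
by rewrite linearD.
Qed.

End Tvs.

(** * Metrizability, completeness and embeddings *)

Lemma metrizable_hausdorff (R : realType) (T : topologicalType) :
  metrizable R T -> hausdorff_space T.
Proof.
move=> [d [d0 dC dT dn]] p q pq; apply/d0.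
have dge x y : 0 <= d x y.
  by have := dT y x x; rewrite (d0 x x).2// (dC y x) -mulr2n pmulrn_lge0.
apply/eqP; rewrite eq_le dge andbT leNgt; apply/negP => dpq.
have h : 0 < d p q / 2 by rewrite divr_gt0.
have [||z [/= pz qz]] := pq [set z | d p z < d p q / 2] [set z | d q z < d p q / 2].
- by rewrite dn; exists (d p q / 2).
- by rewrite dn; exists (d p q / 2).
by have := dT z p q; rewrite [d z q]dC leNgt [X in _ < X]splitr ltrD.
Qed.

Lemma metrizable_kappa_frechet_urysohn (R : realType) (T : topologicalType) :
  metrizable R T -> kappa_frechet_urysohn T.
Proof.
move=> [d [_ _ _ dn]] U _ x xU.
have /choice[u uP] : forall n : nat, exists y, U y /\ d x y < n.+1%:R^-1.
  move=> n; have [|y [Uy xy]] := xU [set y | d x y < n.+1%:R^-1].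
    by rewrite dn; exists n.+1%:R^-1 => //=; rewrite invr_gt0.
  by exists y.
exists u; split=> [n|A]; first by have [] := uP n.
rewrite dn => -[e /= e0 eA].
have [N _ Ne] := near_infty_natSinv_lt (PosNum e0).
exists N => // n /= Nn; apply: eA => /=; apply: lt_trans (Ne n Nn).
by have [] := uP n.
Qed.

Section Embedding.
Context {K : numFieldType}.

Lemma embedding_nbhs0 (S T : tvsType K) (f : {linear S -> T}) A :
  topological_embedding f -> nbhs (0 : S) A ->
  exists2 B, nbhs (0 : T) B & f @^-1` B `<=` A.
Proof.
move=> [_ emb]; rewrite nbhsE => -[Q [oQ Q0] QA].
have [B oB fB] := (emb Q).1 oQ; exists B; last by rewrite fB.
apply: open_nbhs_nbhs; split=> //.
by move: Q0; rewrite -fB/= linear0.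
Qed.

Lemma embedding_continuous (S T : topologicalType) (f : S -> T) :
  topological_embedding f -> continuous f.
Proof. by move=> [_ emb]; apply/continuousP => B oB; apply/emb; exists B. Qed.

(** If [z] is in the closure of the range, the traces on [S] of the
neighbourhoods of [z] form a Cauchy filter, as [f] is an embedding; by
continuity [f] maps its limit to a point that cannot be separated from [z]. *)
Lemma complete_range_closed (S T : tvsType K) (f : {linear S -> T}) :
  topological_embedding f -> tvs_complete S -> hausdorff_space T ->
  closed (range f).
Proof.
move=> femb Scomp hT z zcl.
pose G := filter_from (nbhs z) (fun N => f @^-1` N).
have Gfilter : ProperFilter G.
  apply: filter_from_proper; last first.
    by move=> N /zcl[_ [[x _ <-] Nx]]; exists x.
  apply: filter_from_filter; first by exists setT; exact: filterT.
  by move=> P Q zP zQ; exists (P `&` Q) => //; exact: filterI.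
have [|l Gl] := Scomp G Gfilter.
  move=> A /= /(embedding_nbhs0 femb)[B B0 BA].
  have [C C0 CB] := tvs_nbhs_half B0.
  pose C' := [set z + c | c in C `&` [set x | C (- x)]].
  have zC' : nbhs z C'.
    apply: nbhsT; apply: filterI => //.
    by apply: filterS (tvs_nbhsZ (-1) C0) => x /=; rewrite scaleN1r.
  exists (f @^-1` C', f @^-1` C') => /=; first by split; exists C'.
  move=> [x y] /= [[c [Cc _] zc] [c' [_ Cc'] zc']]; apply: BA => /=.
  by rewrite linearB -zc -zc' opprD addrACA subrr add0r; exact: CB.
exists l => //; apply: hT => A B lA zB.
have : G (f @^-1` (A `&` B)).
  apply: filterI; first by apply: Gl; exact: (embedding_continuous femb).
  by exists B.
by case/filter_ex => x; exists (f x).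
Qed.
End Embedding.

(** * Quotients and products of vector spaces *)

Section Quot.
Context {K : fieldType} (V : lmodType K) (S : {pred V}) (clS : submod_closed S).

(** Carries the proof that [S] is a submodule, for the inference of structures
on the quotient by [S]. *)
Definition submod_pred of submod_closed S : {pred V} := S.

HB.instance Definition _ :=
  GRing.isZmodClosed.Build V (submod_pred clS) (GRing.submod_closedB clS).

Definition lmod_quot : Type := Quotient.quot (submod_pred clS).

HB.instance Definition _ := GRing.Zmodule.on lmod_quot.

Definition lmod_pi (x : V) : lmod_quot := (\pi_(Quotient.quot (submod_pred clS)) x)%qT.

Definition lmod_quot_scale (a : K) (x : lmod_quot) : lmod_quot :=
  lmod_pi (a *: repr (x : Quotient.quot (submod_pred clS))).

Lemma lmod_pi_eq x y : (lmod_pi x = lmod_pi y) <-> x - y \in S.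
Proof.
have -> : (x - y \in S) = (lmod_pi x == lmod_pi y).
  exact: (Quotient.idealrBE (submod_pred clS)).
by split=> /eqP.
Qed.

Lemma lmod_pi_additive : zmod_morphism lmod_pi.
Proof. by move=> x y; rewrite /lmod_pi raddfB. Qed.
HB.instance Definition _ := GRing.isZmodMorphism.Build V lmod_quot lmod_pi lmod_pi_additive.

Lemma lmod_piZ a x : lmod_pi (a *: x) = lmod_quot_scale a (lmod_pi x).
Proof.
apply/lmod_pi_eq; rewrite -scalerBr -[_ *: _]addr0.
have [S0 Slin] := clS; apply: Slin => //; apply/lmod_pi_eq.
by rewrite /lmod_pi reprK.
Qed.

Lemma lmod_pi_surj (x : lmod_quot) : exists y, x = lmod_pi y.
Proof. by exists (repr (x : Quotient.quot (submod_pred clS))); rewrite /lmod_pi reprK. Qed.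

Let scaleA a b v : lmod_quot_scale a (lmod_quot_scale b v) = lmod_quot_scale (a * b) v.
Proof. by have [y ->] := lmod_pi_surj v; rewrite -!lmod_piZ scalerA. Qed.
Let scale1 : left_id 1 lmod_quot_scale.
Proof. by move=> v; have [y ->] := lmod_pi_surj v; rewrite -!lmod_piZ scale1r. Qed.
Let scaleDr : right_distributive lmod_quot_scale +%R.
Proof.
move=> a v w; have [y ->] := lmod_pi_surj v; have [z ->] := lmod_pi_surj w.
by rewrite -raddfD -!lmod_piZ -raddfD scalerDr.
Qed.
Let scaleDl v : {morph lmod_quot_scale^~ v : a b / a + b}.
Proof.
by move=> a b; have [y ->] := lmod_pi_surj v; rewrite -!lmod_piZ -raddfD scalerDl.
Qed.
HB.instance Definition _ := GRing.Zmodule_isLmodule.Build K lmod_quot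
  scaleA scale1 scaleDr scaleDl.

HB.instance Definition _ := GRing.isScalable.Build K V lmod_quot *:%R lmod_pi lmod_piZ.

End Quot.

Section Prod.
Context {K : fieldType} (F : nat -> lmodType K).
Definition lmod_prod : Type := forall n, F n.
HB.instance Definition _ := gen_eqMixin lmod_prod.
HB.instance Definition _ := gen_choiceMixin lmod_prod.
Implicit Types f g : lmod_prod.
Let add f g : lmod_prod := fun n => f n + g n.
Let opp f : lmod_prod := fun n => - f n.
Let zero : lmod_prod := fun n => 0.
Let scale (a : K) f : lmod_prod := fun n => a *: f n.
Let addA : associative add.
Proof. by move=> f g h; apply: functional_extensionality_dep => n; rewrite /add addrA. Qed.
Let addC : commutative add.
Proof. by move=> f g; apply: functional_extensionality_dep => n; rewrite /add addrC. Qed.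
Let add0 : left_id zero add.
Proof. by move=> f; apply: functional_extensionality_dep => n; rewrite /add add0r. Qed.
Let addN : left_inverse zero opp add.
Proof. by move=> f; apply: functional_extensionality_dep => n; rewrite /add addNr. Qed.
HB.instance Definition _ := GRing.isZmodule.Build lmod_prod addA addC add0 addN.
Let scA a b f : scale a (scale b f) = scale (a * b) f.
Proof. by apply: functional_extensionality_dep => n; rewrite /scale scalerA. Qed.
Let sc1 : left_id 1 scale.
Proof. by move=> f; apply: functional_extensionality_dep => n; rewrite /scale scale1r. Qed.
Let scDr : right_distributive scale +%R.
Proof. by move=> a f g; apply: functional_extensionality_dep => n; rewrite /scale scalerDr. Qed.
Let scDl f : {morph scale^~ f : a b / a + b}.
Proof. by move=> a b; apply: functional_extensionality_dep => n; rewrite /scale scalerDl. Qed.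
HB.instance Definition _ := GRing.Zmodule_isLmodule.Build K lmod_prod scA sc1 scDr scDl.

Lemma lmod_prodD f g n : (f + g) n = f n + g n. Proof. by []. Qed.
Lemma lmod_prodZ a f n : (a *: f) n = a *: f n. Proof. by []. Qed.
End Prod.

(** The sequence whose terms are 0 before the index [m], [x] at [m], and then
each the image of the preceding one.  The family [F] is shifted in the
recursive call, which avoids casts between the types [F k]. *)
Fixpoint thread (K : fieldType) m : forall (F : nat -> lmodType K)
    (j : forall n, {linear F n -> F n.+1}), F m -> lmod_prod F :=
  match m with
  | 0 => fun F j x => nat_rect F x (fun n => j n)
  | m'.+1 => fun F j x k => match k with
     | 0 => 0
     | k'.+1 => @thread K m' (fun n => F n.+1) (fun n => j n.+1) x k'
     end
  end.

Section Thread.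
Context {K : fieldType}.
Implicit Types (F : nat -> lmodType K).

Lemma thread_linear F (j : forall n, {linear F n -> F n.+1}) m :
  linear (thread j (m := m)).
Proof.
move=> a x y; apply: functional_extensionality_dep => k; rewrite [RHS]/=.
elim: m F j x y k => [|m IH] F j x y k.
  by elim: k => //= k ->; rewrite linearP.
by case: k => [|k]; [rewrite lmod_prodD lmod_prodZ/= scaler0 addr0|exact: IH].
Qed.
HB.instance Definition _ F (j : forall n, {linear F n -> F n.+1}) m :=
  GRing.isLinear.Build K (F m) (lmod_prod F) *:%R
    (thread j (m := m)) (thread_linear j (m := m)).

Lemma thread_diag F (j : forall n, {linear F n -> F n.+1}) m (x : F m) :
  thread j x m = x.
Proof. by elim: m F j x => [|m IH] F j x //=; exact: IH. Qed.

Lemma thread_next F (j : forall n, {linear F n -> F n.+1}) m (x : F m) k :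
  (m <= k)%N -> thread j x k.+1 = j k (thread j x k).
Proof. by elim: m F j x k => [|m IH] F j x [|k] //= mk; exact: IH. Qed.

Lemma thread_shift F (j : forall n, {linear F n -> F n.+1}) m (x : F m) k :
  (m < k)%N -> thread j (j m x) k = thread j x k.
Proof.
elim: k => // k IH; rewrite ltnS leq_eqVlt => /orP[/eqP mk|mk].
  by subst k; rewrite thread_diag thread_next// thread_diag.
by rewrite !thread_next// ?IH// ltnW.
Qed.
End Thread.

Section EventuallyZero.
Context {K : fieldType} (F : nat -> lmodType K).
Definition eventually_zero : {pred lmod_prod F} :=
  fun f => `[< exists N, forall n, (N <= n)%N -> f n = 0 >].

Lemma eventually_zero_submod : submod_closed eventually_zero.
Proof.
split; first by apply/asboolP; exists 0%N.
move=> a f g /asboolP[N fN] /asboolP[M gM]; apply/asboolP; exists (maxn N M) => n.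
rewrite geq_max => /andP[Nn Mn].
by rewrite lmod_prodD lmod_prodZ fN// gM// scaler0 addr0.
Qed.
End EventuallyZero.

(** * The space underlying a locally convex direct limit, and its topology *)

Section Colimit.
Context {K : numFieldType} (F : nat -> tvsType K) (j : forall n, {linear F n -> F n.+1}).
Context (E : tvsType K) (i : forall n, {linear F n -> E}).
Hypothesis limE : lc_direct_limit j i.

Lemma limit_step n x : i n.+1 (j n x) = i n x.
Proof. by have [_ + _] := limE; apply. Qed.

Lemma limit_range m n x : (m <= n)%N -> exists y, i n y = i m x.
Proof.
elim: n => [|n IH]; first by rewrite leqn0 => /eqP m0; subst m; exists x.
rewrite leq_eqVlt => /orP[/eqP mn|]; first by subst m; exists x.
by rewrite ltnS => /IH[y <-]; exists (j n y); rewrite limit_step.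
Qed.

Lemma limit_common_stage m n x y : exists N x' y', i N x' = i m x /\ i N y' = i n y.
Proof.
have [x' ?] := limit_range x (leq_maxl m n); have [y' ?] := limit_range y (leq_maxr m n).
by exists (maxn m n), x', y'.
Qed.

Definition stage_union : {pred E} := fun y => `[< exists n x, y = i n x >].

Lemma stage_union_submod : submod_closed stage_union.
Proof.
split; first by apply/asboolP; exists 0%N, 0; rewrite linear0.
move=> a y z /asboolP[m [x ->]] /asboolP[n [x' ->]]; apply/asboolP.
have [N [u [v [<- <-]]]] := limit_common_stage x x'.
by exists N, (a *: u + v); rewrite linearP.
Qed.

(** The projection of [E] onto its quotient by the union of the stages and the
zero map agree on every stage, so they are equal. *)
Lemma limit_surj y : exists n x, y = i n x.
Proof.
pose G := indiscrete (lmod_quot stage_union_submod).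
pose p : {linear E -> G} := to_lctvs (indiscrete_base _) \o lmod_pi stage_union_submod.
have [_ _ /(_ G (fun=> \0))[||h [_ _ hU]]] := limE.
- by move=> n; exact: indiscrete_continuous.
- by [].
have p0 : forall n x, p (i n x) = 0.
  move=> n x; rewrite -[RHS](linear0 p); apply/(@lmod_pi_eq _ _ _ stage_union_submod).
  by rewrite subr0; apply/asboolP; exists n, x.
have py : p y = p 0.
  rewrite linear0 (hU p _ p0); last exact: indiscrete_continuous.
  by rewrite -(hU \0)//; exact: indiscrete_continuous.
move: py => /(@lmod_pi_eq _ _ _ stage_union_submod).
by rewrite subr0 => /asboolP.
Qed.

(** The threads issued from [x] and from [j m x] differ at the index [m] only,
so the classes of threads modulo eventually zero sequences form a cocone.  When
the [j n] are injective, the thread issued from a nonzero [x] has no zero term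
from its start on. *)
Lemma limit_inj : (forall n, injective (j n)) -> forall n, injective (i n).
Proof.
move=> jinj n; apply/raddf_inj => x ix0.
pose F' n : lmodType K := F n.
pose j' n : {linear F' n -> F' n.+1} := j n.
pose cl := @eventually_zero_submod K F'.
pose t m : {linear F' m -> lmod_prod F'} := thread j' (m := m).
pose p : {linear lmod_prod F' -> lmod_quot cl} := lmod_pi cl.
pose G := indiscrete (lmod_quot cl).
pose g m : {linear F m -> G} :=
  (to_lctvs (indiscrete_base _) \o p) \o t m.
have [_ _ /(_ G g)[||h [_ hg _]]] := limE.
- by move=> m; exact: indiscrete_continuous.
- move=> m z; apply/(@lmod_pi_eq _ _ _ cl); apply/asboolP; exists m.+1 => k mk.
  by rewrite [LHS](_ : _ = thread j (j m z) k - thread j z k)// thread_shift// subrr.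
have /(@lmod_pi_eq _ _ _ cl) : g n x = g n 0.
  by rewrite -!hg ix0 linear0.
rewrite linear0 subr0 => /asboolP[N xN].
have tinj : forall k, (n <= k)%N -> thread j x k = 0 -> x = 0.
  move=> k /subnK <-; elim: (k - n)%N => [|d IH]; first by rewrite thread_diag.
  rewrite addSn thread_next ?leq_addl// => jt; apply: IH; apply: (jinj (d + n)%N).
  by rewrite jt linear0.
by apply: (tinj (maxn n N)); [exact: leq_maxl|apply: xN; exact: leq_maxr].
Qed.

(** A base of the finest locally convex topology on [E] for which the [i n] are
continuous. *)
Definition final_disk : set (set E) :=
  [set V | disk V /\ forall n, nbhs (0 : F n) (i n @^-1` V)].

Lemma final_disk_base : lc_base final_disk.
Proof.
split.
- by exists setT; split=> // n; exact: filterT.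
- move=> U W [[Ub Uc] U0] [[Wb Wc] W0]; split; last first.
    by move=> n; exact: (filterI (U0 n) (W0 n)).
  split=> [t x t1 [Ux Wx]|a x y a01 [Ux Wx] [Uy Wy]].
    by split; [exact: Ub|exact: Wb].
  by split; [exact: (Uc a x y)|exact: (Wc a x y)].
- by move=> U [].
- move=> c U [[Ub Uc] U0]; split.
    split=> [t x t1 Ux|a x y a01 Ux Uy] /=.
      by rewrite scalerA mulrC -scalerA; exact: Ub.
    by rewrite scalerDr !scalerA ![c * _]mulrC -!scalerA; exact: Uc.
  by move=> n; apply: filterS (tvs_nbhsZ c (U0 n)) => x /=; rewrite linearZ.
- move=> U y [_ U0]; have [n [x ->]] := limit_surj y.
  have [d d0 dU] := tvs_absorb x (U0 n); exists d => // t /dU /=.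
  by rewrite linearZ.
Qed.

(** The universal property gives a continuous linear map from [E] to [E] with
its final topology.  It fixes every stage, hence is the identity, because the
stages cover [E]. *)
Lemma limit_nbhs (V : set E) : disk V -> (forall n, nbhs (0 : F n) (i n @^-1` V)) ->
  nbhs (0 : E) V.
Proof.
move=> dV nV; pose G : tvsType K := lctvs final_disk_base.
pose g n : {linear F n -> G} := to_lctvs final_disk_base \o i n.
have [_ _ /(_ G g)[||h [hc hg _]]] := limE.
- move=> n; apply: tvs_linear_continuous => A /lctvs_nbhs[U [_ /(_ n) Un] UA].
  by apply: filterS Un => x /= /UA.
- by move=> n x /=; rewrite limit_step.
have hid y : h y = y by have [n [x ->]] := limit_surj y; rewrite hg.
have nGV : nbhs (h 0) (V : set G).
  by rewrite hid; apply/lctvs_nbhs; exists V.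
suff -> : V = h @^-1` V by exact: hc nGV.
by apply/seteqP; split=> y /=; rewrite hid.
Qed.

End Colimit.

(** * Stages of a strict direct limit *)

Section Stages.
Context {K : numFieldType} (F : nat -> tvsType K) (j : forall n, {linear F n -> F n.+1}).
Context (E : tvsType K) (i : forall n, {linear F n -> E}).
Hypothesis limE : lc_direct_limit j i.
Hypothesis jemb : forall n, topological_embedding (j n).
Hypothesis jcl : forall n, closed (range (j n)).

Lemma stage_inj n : injective (i n).
Proof. by apply: (limit_inj limE) => m; have [] := jemb m. Qed.

Lemma stage_le m n : (m <= n)%N -> range (i m) `<=` range (i n).
Proof.
by move=> mn _ [x _ <-]; have [y yx] := limit_range limE x mn; exists y.
Qed.

Lemma stage_lin n a x y : range (i n) x -> range (i n) y -> range (i n) (a *: x + y).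
Proof. by move=> [u _ <-] [v _ <-]; exists (a *: u + v) => //; rewrite linearP. Qed.

Lemma stageD n x y : range (i n) x -> range (i n) y -> range (i n) (x + y).
Proof. by move=> Rx Ry; rewrite -[x]scale1r; exact: stage_lin. Qed.

Lemma stageB n x y : range (i n) x -> range (i n) y -> range (i n) (x - y).
Proof. by move=> Rx Ry; rewrite addrC -scaleN1r; exact: stage_lin. Qed.

Section Avoiding.
Variable Y : set E.
Hypothesis Yfin : forall n, finite_set (Y `&` range (i n)).

(** The choice of the disk [W] of [F n.+1] that follows the disk [A] of [F n].
The first condition makes [W + W] meet stage [n] inside [A], which is possible
since [j n] is an embedding.  The second one says that the translates by
[W + W] of the points of [Y] which are new in stage [n.+1] do not meet stage
[n]; it concerns finitely many points, each of them outside of the closed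
subspace [range (j n)].  The conditions bear on [W + W] and not on [W]
to leave room for the disks chosen later.  The assumption on [A] is placed
after the existential so that the choice can be iterated. *)
Lemma avoiding_disk_step n (A : set (F n)) : exists W : set (F n.+1), nbhs 0 A ->
  [/\ nbhs 0 W, disk W,
      forall w w' x, W w -> W w' -> j n x = w + w' -> A x &
      forall y w w', Y y -> W w -> W w' -> range (i n.+1) y ->
        range (i n) (y - i n.+1 (w + w')) -> range (i n) y].
Proof.
have [A0|nA] := pselect (nbhs 0 A); last by exists setT => /nA.
have [Q Q0 QA] := embedding_nbhs0 (jemb n) A0.
have [D YD] := finite_fsetP.1 (Yfin n.+1).
pose N y := [set w | range (i n) (y - i n.+1 w) -> range (i n) y].
have N0 : nbhs (0 : F n.+1) (\bigcap_(y in [set` D]) N y).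
  apply: filter_bigI => y yD.
  have [_ [z _ zy]] : (Y `&` range (i n.+1)) y by rewrite YD.
  have [Ry|nRy] := pselect (range (i n) y); first by apply: filterS filterT => w _ _.
  have nz : ~ range (j n) z.
    by move=> [x _ xz]; apply: nRy; exists x => //; rewrite -(limit_step limE) xz.
  have ojn : open (~` range (j n)) by apply: closed_openC; exact: jcl.
  have : nbhs z (~` range (j n)).
    by apply: open_nbhs_nbhs; split=> //; exact: nz.
  move=> /tvs_nbhs/(tvs_nbhsZ (-1)); apply: filterS => w /= zw [x _ xw].
  case: zw; exists x => //; apply: (@stage_inj n.+1).
  by rewrite (limit_step limE) xw scaleN1r linearB zy.
have [P P0 PQ] := tvs_nbhs_half (filterI Q0 N0).
have [W [W0 dW WP]] := tvs_disk P0; exists W => _; split => //.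
  move=> w w' x Ww Ww' jx; apply: QA => /=; rewrite jx.
  by have [] := PQ _ _ (WP _ Ww) (WP _ Ww').
move=> y w w' Yy Ww Ww' Ry; have [_] := PQ _ _ (WP _ Ww) (WP _ Ww').
by apply; rewrite -YD.
Qed.

Lemma avoiding_nbhs p : (forall y, Y y -> ~ range (i p) y) ->
  exists2 V, nbhs (0 : E) V & forall y r v, Y y -> range (i p) r -> V v -> y <> r + v.
Proof.
move=> Yp.
pose next n (A : set (F n)) := sval (cid (avoiding_disk_step A)).
pose W : forall n, set (F n) := nat_rect (fun n => set (F n)) setT next.
have W0 n : nbhs (0 : F n) (W n).
  elim: n => [|n IH]; first exact: filterT.
  by have [] := svalP (cid (avoiding_disk_step (W n))) IH.
have WP n := svalP (cid (avoiding_disk_step (W n))) (W0 n).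
have dW n : disk (W n) by case: n => [|n]; [split|have [] := WP n].
(* [A n] is the sum [W 0 + ... + W n] computed in [E]. *)
pose A : nat -> set E := nat_rect _ (i 0%N @` W 0%N)
  (fun n An => [set x + y | x in An & y in i n.+1 @` W n.+1]).
have dA n : disk (A n).
  by elim: n => [|n IH]; [exact: disk_image|apply: disk_sum => //; exact: disk_image].
have iW0 n : (i n @` W n) 0 by exists 0; [exact: (nbhs_singleton (W0 n))|rewrite linear0].
have A0 n : A n 0.
  elim: n => [|n IH]; first exact: iW0.
  by exists 0 => //; exists 0; rewrite ?addr0.
have AS n : A n `<=` A n.+1.
  by move=> x Ax; exists x => //; exists 0 => //; rewrite addr0.
have Ale m n : (m <= n)%N -> A m `<=` A n.
  move=> /subnK <-; elim: (n - m)%N => [//|d IH]; rewrite addSn.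
  exact: subset_trans (AS _).
have WA n : i n @` W n `<=` A n.
  case: n => [//|n] x Wx; exists 0 => //; exists x => //; exact: add0r.
have AR n : A n `<=` range (i n).
  elim: n => [|n IH]; first by move=> _ [x _ <-]; exists x.
  move=> _ [x /IH Rx] [_ [y _ <-]] <-; apply: stageD; last by exists y.
  exact: stage_le Rx.
exists (\bigcup_n A n).
  apply: (limit_nbhs limE) => [|n]; last first.
    by apply: filterS (W0 n) => x Wx; exists n => //; apply: WA; exists x.
  split=> [t x t1 [n _ Ax]|a x y a01 [m _ Ax] [n _ Ay]].
    by exists n => //; apply: (dA n).1.
  exists (maxn m n) => //; apply: (dA _).2 => //.
    by apply: Ale Ax; exact: leq_maxl.
  by apply: Ale Ay; exact: leq_maxr.
(* One more copy of [W n] is added to keep the induction going. *)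
suff main n y r a w : Y y -> range (i p) r -> A n a -> W n w -> y <> r + a + i n w.
  move=> y r v Yy Rr [n _ Av] yE.
  have [||||] := main n y r v 0 => //; first exact: (nbhs_singleton (W0 n)).
  by rewrite linear0 addr0.
elim: n a w => [|n IH] a w Yy Rr Aa Ww yE.
  apply: (Yp _ Yy); rewrite yE; apply: stageD.
    by apply: stageD => //; apply: (stage_le (leq0n p)); exact: AR.
  by apply: (stage_le (leq0n p)); exists w.
have [np|pn] := ltnP n p.
  apply: (Yp _ Yy); rewrite yE; apply: stageD.
    by apply: stageD => //; apply: (stage_le np); exact: AR.
  by apply: (stage_le np); exists w.
have [_ _ C1 C2] := WP n.
move: Aa => [a' Aa' [_ [w1 Ww1 <-] aE]].
have yB : y - i n.+1 (w1 + w) = r + a'.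
  by rewrite yE -aE linearD addrA -[r + a' + _ + _]addrA addrK.
have Rra' : range (i n) (r + a').
  by apply: stageD; [exact: stage_le Rr|exact: AR].
(* Were [y] new in stage [n.+1], then [y - (w1 + w)] would not be in stage [n],
which contains [r + a']. *)
have Ry : range (i n) y.
  apply: (C2 y w1 w) => //; last by rewrite yB.
  rewrite yE -aE [r + _]addrA -[r + a' + _ + _]addrA -(linearD (i n.+1)).
  apply: stageD; last by exists (w1 + w).
  exact: stage_le Rra'.
(* So [w1 + w] is in stage [n], hence in [W n], and the extra summand is
absorbed by the one available at step [n]. *)
have [x _ xE] := stageB Ry Rra'.
have jx : j n x = w1 + w.
  by apply: (@stage_inj n.+1); rewrite (limit_step limE) xE -yB opprB addrC subrK.
apply: (IH a' x) => //; first exact: C1 jx.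
by rewrite xE addrC subrK.
Qed.
End Avoiding.

Lemma stage_closed p : closed (range (i p)).
Proof.
move=> y ycl; apply: contrapT => nRy.
have [||V V0 VP] := @avoiding_nbhs [set y] _ p.
- by move=> n; apply: (sub_finite_set (B := [set y])) => // z [].
- by move=> _ ->.
have [|r [Rr Vyr]] := ycl [set z | V (y - z)].
  apply/tvs_nbhs; apply: filterS (tvs_nbhsZ (-1) V0) => u /=.
  by rewrite scaleN1r opprD addrA subrr add0r.
by apply: (VP y r (y - r)) => //; rewrite addrC subrK.
Qed.

(** Otherwise infinitely many terms escape from the stages, the [m]-th of them
from stage [m]; each stage contains finitely many of these, so that some
neighbourhood of 0 contains none of them. *)
Lemma cvg_in_stage (u : nat -> E) : u @ \oo --> (0 : E) ->
  exists N, forall k, (N <= k)%N -> range (i N) (u k).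
Proof.
move=> u0; apply: contrapT => nN.
have /choice[s sP] : forall N, exists k, (N <= k)%N /\ ~ range (i N) (u k).
  move=> N; apply: contrapT => nk; apply: nN; exists N => k Nk.
  by apply: contrapT => Rk; apply: nk; exists k.
have [||V V0 VP] := @avoiding_nbhs (range (u \o s)) _ 0.
- move=> n; apply: (sub_finite_set (B := (u \o s) @` `I_n)) => [y [[m _ <-] Ry]|].
    exists m => //=; rewrite ltnNge; apply/negP => nm.
    by have [_] := sP m; apply; exact: (stage_le nm).
  exact: finite_image (finite_II n).
- by move=> _ [m _ <-] R0; have [_] := sP m; apply; exact: (stage_le (leq0n m)).
have [M _ MV] := u0 V V0; have [Ms _] := sP M.
apply: (VP (u (s M)) 0 (u (s M))); [by exists M| | |by rewrite add0r].
- by exists 0 => //; rewrite linear0.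
- exact: MV.
Qed.

Lemma stage_interior p (x : E) (A : set E) : nbhs x A -> A `<=` range (i p) ->
  range (i p) = setT.
Proof.
move=> /[dup]/nbhs_singleton Ax /tvs_nbhs A0 AR; apply/seteqP; split=> // y _.
have [d d0 dA] := tvs_absorb y A0.
have c0 : d / 2 != 0 by rewrite gt_eqF// divr_gt0.
have -> : y = (d / 2)^-1 *: ((x + (d / 2) *: y) - x) + 0.
  by rewrite addr0 [x + _]addrC addrK scalerA mulVf// scale1r.
apply: stage_lin; last by exists 0 => //; rewrite linear0.
apply: stageB; last exact: AR.
apply: AR; apply: dA; rewrite gtr0_norm ?divr_gt0//.
by rewrite ltr_pdivrMr// mulr_natr mulr2n ltrDl.
Qed.

(** Real and complex scalars are treated together: the convergence of [1/(n+1)]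
to 0 is all that is asked of [K]. *)
Lemma kappa_frechet_urysohn_stage_full :
  (forall e : K, 0 < e -> exists n : nat, n.+1%:R^-1 < e) ->
  kappa_frechet_urysohn E -> exists n, range (i n) = setT.
Proof.
move=> archK kE; apply: contrapT => nstab.
have nR n : range (i n) <> setT by move=> Rn; apply: nstab; exists n.
have [a nRa] : exists a, ~ range (i 0%N) a.
  apply: contrapT => na; apply: (nR 0%N); apply/seteqP; split=> // a _.
  by apply: contrapT => nRa; apply: na; exists a.
(* Topological vector spaces are regular, being uniform. *)
have [C C0 [cC nCa]] : exists2 C, nbhs (0 : E) C & closed C /\ ~ C a.
  have oA : open (~` range (i 0%N)) by apply: closed_openC; exact: stage_closed.
  have : nbhs (0 : E) [set y | ~ range (i 0%N) (a - y)].
    have : nbhs a (~` range (i 0%N)) by exact: open_nbhs_nbhs.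
    move=> /tvs_nbhs/(tvs_nbhsZ (-1)); apply: filterS => y /=.
    by rewrite scaleN1r.
  move=> /uniform_regular[C C0 CA]; exists (closure C).
    by apply: filterS C0; exact: subset_closure.
  split; first exact: closed_closure.
  by move=> /CA /=; rewrite subrr; apply; exists 0 => //; rewrite linear0.
pose U := \bigcup_k ([set y : E | ~ C (k.+1%:R *: y)] `&` ~` range (i k)).
have oG k : open [set y : E | ~ C (k.+1%:R *: y)].
  have := @continuousP E E (fun y => k.+1%:R *: y); move=> [+ _].
  move=> /(_ _ (~` C)); apply; last exact: closed_openC.
  move=> x A /tvs_nbhs/(tvs_nbhsZ k.+1%:R) A0; apply/tvs_nbhs.
  by apply: filterS A0 => z /=; rewrite scalerDr.
have oU : open U.
  apply: bigcup_open => k _; apply: openI; first exact: oG.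
  by apply: closed_openC; exact: stage_closed.
have clU : closure U 0.
  move=> A; rewrite nbhsE => -[B [oB B0] BA].
  have [|d d0 dB] := @tvs_absorb K E B a; first by apply: open_nbhs_nbhs.
  have [k kd] := archK _ d0.
  apply: contrapT => UA.
  apply: (nR k); apply: (@stage_interior k (k.+1%:R^-1 *: a)
    (B `&` [set y | ~ C (k.+1%:R *: y)])).
    apply: open_nbhs_nbhs; split; first exact: openI.
    split => /=; first by apply: dB; rewrite gtr0_norm// invr_gt0.
    by rewrite scalerA mulfV ?pnatr_eq0// scale1r.
  move=> y [By nCy]; apply: contrapT => nRy; apply: UA; exists y; split; last exact: BA.
  by exists k.
have [u [uU u0]] := kE U oU 0 clU.
have [N uN] := cvg_in_stage u0.
have uC : \forall k \near \oo, forall m, (m < N)%N -> C (m.+1%:R *: u k).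
  have : nbhs (0 : E) (\bigcap_(m in `I_N) [set y | C (m.+1%:R *: y)]).
    elim: {uN} N => [|N IH]; first by rewrite II0 bigcap_set0; exact: filterT.
    by rewrite IIS bigcap_setU bigcap_set1; apply: filterI => //; exact: tvs_nbhsZ.
  by move=> /u0[M _ MC]; exists M => // k Mk m mN; exact: (MC k Mk m mN).
have [M _ MC] := uC.
have [m _ [nC nRm]] := uU (maxn M N).
have Rk := uN _ (leq_maxr M N).
have [mN|Nm] := ltnP m N; first by apply: nC; exact: (MC (maxn M N) (leq_maxl M N) m mN).
by apply: nRm; exact: (stage_le Nm).
Qed.

Lemma stage_nbhs_le m d (V : set E) :
  nbhs (0 : F (d + m)%N) (i (d + m)%N @^-1` V) -> nbhs (0 : F m) (i m @^-1` V).
Proof.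
elim: d => [//|d IH] V0; apply: IH.
have -> : i (d + m)%N @^-1` V = j (d + m)%N @^-1` (i (d + m).+1 @^-1` V).
  by apply/seteqP; split=> x /=; rewrite (limit_step limE).
by apply: (embedding_continuous (jemb (d + m))); rewrite linear0.
Qed.

Variable n : nat.
Hypothesis surj : range (i n) = setT.

(** A bijective [i n] is open: the image of a disk of [F n] is a disk of [E]
whose preimages in all the [F m] are neighbourhoods of 0, by continuity for
[m <= n], and because [F n -> F m] is an isomorphism for [n <= m]. *)
Lemma full_stage_nbhs0 A : nbhs (0 : E) A <-> nbhs (0 : F n) (i n @^-1` A).
Proof.
split=> [A0|].
  have [ic _ _] := limE; apply: (ic n 0); by rewrite linear0.
move=> /tvs_disk[W [W0 dW WA]].
apply: (@filterS _ _ _ (i n @` W)); first by move=> _ [x /WA + <-].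
apply: (limit_nbhs limE) => [|m]; first exact: disk_image.
(* Past the index [n] the maps [j] are onto, so that being a neighbourhood of 0
is transferred by the embeddings. *)
have up d : nbhs (0 : F (d + n)%N) (i (d + n)%N @^-1` (i n @` W)).
  elim: d => [|d IH]; first by apply: filterS W0 => x Wx; exists x.
  have [B B0 BW] := embedding_nbhs0 (jemb (d + n)) IH.
  rewrite addSn; apply: filterS B0 => z Bz /=.
  have [x _ xz] : range (i (d + n)%N) (i (d + n).+1 z).
    by apply: (stage_le (leq_addl d n)); rewrite surj.
  have jxz : j (d + n)%N x = z by apply: (@stage_inj (d + n).+1); rewrite (limit_step limE).
  by rewrite -xz; apply: BW; rewrite /= jxz.
by apply: (stage_nbhs_le (m := m) (d := n)); rewrite addnC; exact: up.
Qed.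

Lemma full_stage_nbhs (x : F n) A : nbhs (i n x) A <-> nbhs x (i n @^-1` A).
Proof.
have iA : i n @^-1` [set y | A (i n x + y)] = [set y | (i n @^-1` A) (x + y)].
  by apply/seteqP; split=> y /=; rewrite linearD.
split=> [/tvs_nbhs/full_stage_nbhs0|/tvs_nbhs] A0; apply/tvs_nbhs.
  by rewrite -iA.
by apply/full_stage_nbhs0; rewrite iA.
Qed.

Lemma full_stage_frechet (R : realType) : frechet_space R (F n) -> frechet_space R E.
Proof.
have /choice[f fK] : forall y, exists x, i n x = y.
  by move=> y; have : range (i n) y; [rewrite surj|move=> [x _ <-]; exists x].
have iK x : f (i n x) = x by apply: (@stage_inj n); rewrite fK.
have fB x y : f (x - y) = f x - f y.
  by apply: (@stage_inj n); rewrite linearB !fK.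
move=> [[d [d0 dC dT dn]] comp]; split.
  exists (fun x y => d (f x) (f y)); split=> [x y|x y|y x z|x].
  - by rewrite d0; split=> [xy|->]; [rewrite -[x]fK xy fK|].
  - exact: dC.
  - exact: dT.
  - apply/seteqP; split=> A.
      rewrite -{1}(fK x) => /full_stage_nbhs; rewrite dn => -[e e0 eA].
      by exists e => // y /= /eA /=; rewrite fK.
    move=> -[e e0 eA]; rewrite -(fK x); apply/full_stage_nbhs; rewrite dn.
    by exists e => // y /= xy; apply: eA => /=; rewrite iK.
move=> G GF Gc; have [|l Gl] := comp (f @ G) _.
  move=> A /= A0.
  have /Gc[[P Q] /= [GP GQ] PQ] : nbhs (0 : E) (f @^-1` A).
    by apply/full_stage_nbhs0; apply: filterS A0 => x /=; rewrite iK.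
  exists (f @` P, f @` Q) => /=.
    by split; [move: GP|move: GQ]; apply: (@filterS _ G) => x ?; exists x.
  by move=> [_ _] /= [[x Px <-] [y Qy <-]]; rewrite -fB; apply: (PQ (x, y)).
exists (i n l) => A /full_stage_nbhs/Gl fA.
suff -> : A = f @^-1` (i n @^-1` A) by exact: fA.
by apply/seteqP; split=> y /=; rewrite fK.
Qed.

End Stages.

(** * The equivalence *)

Theorem strict_LF_kappa_frechet_urysohn (R : realType) (K : numFieldType) (E : tvsType K) :
  (forall e : K, 0 < e -> exists n : nat, n.+1%:R^-1 < e) ->
  strict_LF_space R E -> (kappa_frechet_urysohn E <-> frechet_space R E).
Proof.
move=> archK [F [j [i [Ffr jemb limE]]]]; split=> [kE|[mE _]]; last first.
  exact: metrizable_kappa_frechet_urysohn mE.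
have jcl n : closed (range (j n)).
  apply: complete_range_closed => //; first by have [] := Ffr n.
  by apply: (@metrizable_hausdorff R); have [] := Ffr n.+1.
have [n Rn] := kappa_frechet_urysohn_stage_full limE jemb jcl archK kE.
exact: (full_stage_frechet limE jemb Rn).
Qed.

Theorem corollary2p11 (R : realType) :
  (forall E : tvsType R,
     strict_LF_space R E -> (kappa_frechet_urysohn E <-> frechet_space R E)) /\
  (forall E : tvsType (complex R),
     strict_LF_space R E -> (kappa_frechet_urysohn E <-> frechet_space R E)).
Proof.
have archR (e : R) : 0 < e -> exists n : nat, n.+1%:R^-1 < e.
  move=> e0; have [N _ Ne] := near_infty_natSinv_lt (PosNum e0).
  by exists N; apply: Ne => /=.
split=> E; apply: strict_LF_kappa_frechet_urysohn => // e.
rewrite ltcE /= => /andP[/eqP e1 /archR[n ne]]; exists n.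
rewrite (_ : _^-1 = (n.+1%:R^-1)%:C%C); last by rewrite fmorphV rmorph_nat.
by rewrite ltcE /= e1 eqxx.
Qed.
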